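(* Let $c,\sigma>0$ be constants and let a Runge-Kutta method with Runge-Kutta matrix $G$ and weights $w$ be applied, with time step $\tau$, to the Fourier-side systems (S1), (S2), (S3) of the context, $k\in[N]^*$, where $h=2\pi/N$. Let $e$ be the vector of ones, $\nu=c\sigma|k|$, and $$\psi(\tau,\nu)=\sqrt{\frac{\left|\det\left(I+\tau^2\nu(G-ew^T)^2\right)\right|}{\left|\det\left(I+\tau^2\nu G^2\right)\right|}} .$$ 1. For any Runge-Kutta method, if a CFL condition holds, i.e. $\tau\le Ch$ for some positive real number $C$, then the scheme for the system (S3), (S1) or (S2) is stable. More specifically: (a) if $\mathrm{tr}(G^2)>\mathrm{tr}\left((G-ew^T)^2\right)$, then $\psi(\tau,\nu)<1$ when $\tau$ goes to $0$, which means strong stability; (b) if $\mathrm{tr}(G^2)\le\mathrm{tr}\left((G-ew^T)^2\right)$, then $\psi(\tau,\nu)\le 1+L\tau+O(\tau^2)$ when $\tau$ goes to $0$, where $0\le L\le \mathrm{tr}\left((G-ew^T)^2-G^2\right)c\sigma C\pi/2$, which means weak stability. 2. For any Runge-Kutta method whose absolute stability region contains a part of the imaginary axis $[-C_1i,C_1i]$, there exists $C_2>0$ such that when $\tau\le C_2\sqrt{h}$, the scheme is strongly stable.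
   Context: $N$ is an even positive integer, $h=2\pi/N$ is the spatial grid size, and $[N]^*=\{-\tfrac N2+1,\dots,\tfrac N2\}$ is the set of discrete Fourier modes. The nonlocal hyperbolic system $u_t=\sigma\Lambda v$, $v_t=-cu$ on $\mathbb{T}=\mathbb{R}/2\pi\mathbb{Z}$ (with constants $\sigma,c>0$ and $\Lambda=(-\Delta)^{1/2}$ the operator with Fourier symbol $|k|$) is discretized in space by the Fourier spectral method. For each mode $k$ this gives (S1) $\partial_t(\hat u,\hat v)^T=A(\hat u,\hat v)^T$, with $A=\begin{pmatrix}0&\sigma|k|\\-c&0\end{pmatrix}$. Setting $\hat w=\sqrt{\sigma|k|/c}\,\hat v$ gives (S2) $\partial_t(\hat u,\hat w)^T=Q(\hat u,\hat w)^T$, with $Q=\begin{pmatrix}0&\sqrt{c\sigma|k|}\\-\sqrt{c\sigma|k|}&0\end{pmatrix}$, and diagonalizing $Q$, whose eigenvalues are $\pm i\sqrt\nu$ with $\nu=c\sigma|k|$, gives (S3) $\partial_t(\hat u_1,\hat v_1)^T=\mathrm{diag}(i\sqrt\nu,-i\sqrt\nu)(\hat u_1,\hat v_1)^T$. A Runge-Kutta method is given by its Butcher tableau, with real square matrix $G$ and real weight vector $w$; $I$ is the identity matrix of the same size as $G$. Applied to $y'=\lambda y$ with time step $\tau$ it reads $y_{n+1}=f(\tau\lambda)y_n$, where $f(z)=1+zw^T(I-zG)^{-1}e$. Its absolute stability region is $\{z\in\mathbb{C}:|f(z)|\le1\}$. The growth matrix of the method is the matrix mapping the numerical solution at step $n$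 to that at step $n+1$. The quantity $\psi(\tau,\nu)$ is the common modulus of the two eigenvalues of the growth matrix, and for (S2) it equals the spectral ($2$-)norm of the growth matrix. Strong stability means that $\psi(\tau,\nu)\le 1$; weak stability means a bound $\psi(\tau,\nu)\le 1+L\tau+O(\tau^2)$ with $L\ge 0$.
   Formalization: In 1(a) the strict bound ψ<1 is stated only for modes k≠0, since at k=0 one has ν=0 and ψ=1 for every method; ψ≤1 (strong stability) is stated for all k, including k=0. *)

(* Defs.v *)
From HB Require Import structures.
From mathcomp Require Import all_boot all_order all_algebra.
From mathcomp Require Import all_classical all_reals all_analysis.
From mathcomp Require Export complex.

Set Implicit Arguments.
Unset Strict Implicit.
Unset Printing Implicit Defensive.

Import Order.TTheory GRing.Theory Num.Theory.
Import numFieldNormedType.Exports.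

Local Open Scope ring_scope.
Local Open Scope complex_scope.
Local Open Scope classical_set_scope.

Notation cmod := ComplexField.Normc.normc.

Section Fourier.
Context {R : realType}.

Definition mesh (N : nat) : R := 2 * pi / N%:R.

Definition modes (N : nat) : pred int :=
  [pred k : int | - (N./2)%:Z + 1 <= k <= (N./2)%:Z].

Definition abs_mode (k : int) : R := `|k%:~R|.

Definition nu (c sigma : R) (k : int) : R := c * sigma * abs_mode k.

(* The symbols of the systems are 2 x 2 complex matrices, written by blocks
   of size 1. *)
Definition mx22 (a b d g : R[i]) : 'M[R[i]]_2 :=
  block_mx (a%:M : 'M[R[i]]_1) (b%:M : 'M[R[i]]_1) (d%:M : 'M[R[i]]_1) (g%:M : 'M[R[i]]_1).

Definition S1 (c sigma : R) (k : int) : 'M[R[i]]_2 :=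
  mx22 0 (sigma * abs_mode k)%:C (- c)%:C 0.

Definition S2 (c sigma : R) (k : int) : 'M[R[i]]_2 :=
  mx22 0 (Num.sqrt (nu c sigma k))%:C (- Num.sqrt (nu c sigma k))%:C 0.

Definition S3 (c sigma : R) (k : int) : 'M[R[i]]_2 :=
  mx22 (0 +i* Num.sqrt (nu c sigma k)) 0 0 (0 -i* Num.sqrt (nu c sigma k)).

End Fourier.

Section RungeKutta.
Context {R : realType} {s : nat}.
Variables (G : 'M[R]_s.+1) (w : 'cV[R]_s.+1).

(* One step for y' = A y: the stage slopes K_i solve
   K_i = A (y + tau sum_j G_ij K_j), then y1 = y + tau sum_i w_i K_i. *)
Definition rk_step (tau : R) (A : 'M[R[i]]_2) (y y1 : 'cV[R[i]]_2) : Prop :=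
  exists2 K : 'I_s.+1 -> 'cV[R[i]]_2,
    forall i, K i = A *m (y + tau%:C *: \sum_j (G i j)%:C *: K j) &
    y1 = y + tau%:C *: \sum_i (w i 0)%:C *: K i.

(* The equivalence makes the step well defined (every y has exactly one
   successor), so at most one M qualifies. *)
Definition growth_matrix (tau : R) (A M : 'M[R[i]]_2) : Prop :=
  forall y y1, rk_step tau A y y1 <-> y1 = M *m y.

Definition l2norm (x : 'cV[R[i]]_2) : R :=
  Num.sqrt (\sum_i cmod (x i 0) ^+ 2).

Definition spectral_norm (M : 'M[R[i]]_2) : R :=
  sup [set l2norm (M *m x) | x in [set x | l2norm x = 1]].

Definition common_modulus (M : 'M[R[i]]_2) (r : R) : Prop :=
  forall l : R[i], eigenvalue M l -> cmod l = r.

Definition GmewT : 'M[R]_s.+1 := G - (const_mx 1 : 'cV_s.+1) *m w^T.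

Definition psi (tau nu : R) : R :=
  Num.sqrt (`|\det (1%:M + (tau ^+ 2 * nu) *: (GmewT ^+ 2))|
            / `|\det (1%:M + (tau ^+ 2 * nu) *: (G ^+ 2))|).

(* The schemes at mode k are well posed and psi is the amplification factor
   of each of them. *)
Definition psi_is_growth (c sigma tau : R) (k : int) : Prop :=
  [/\ exists2 M, growth_matrix tau (S1 c sigma k) M &
        common_modulus M (psi tau (nu c sigma k)),
      exists2 M, growth_matrix tau (S2 c sigma k) M &
        common_modulus M (psi tau (nu c sigma k)) /\
        spectral_norm M = psi tau (nu c sigma k) &
      exists2 M, growth_matrix tau (S3 c sigma k) M &
        common_modulus M (psi tau (nu c sigma k))].

Definition toC {m n} (B : 'M[R]_(m, n)) : 'M[R[i]]_(m, n) :=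
  map_mx (real_complex R) B.

Definition stability_function (z : R[i]) : R[i] :=
  1 + z * ((toC w)^T *m invmx (1%:M - z *: toC G) *m (const_mx 1 : 'cV_s.+1)) 0 0.

(* [invmx] is total, so the domain of the stability function is explicit. *)
Definition stability_region : set R[i] :=
  [set z | (1%:M - z *: toC G) \in unitmx /\
           cmod (stability_function z) <= 1].

End RungeKutta.

(* Main.v *)
Require Import Defs.
From mathcomp Require Import all_boot all_order all_algebra.
From mathcomp Require Import all_classical all_reals all_analysis.
From mathcomp Require Import ring lra.
Import Order.TTheory GRing.Theory Num.Theory.
Import numFieldNormedType.Exports.
Local Open Scope ring_scope.
Local Open Scope complex_scope.
Local Open Scope classical_set_scope.

(** The three systems share the identity [A^2 = - nu I], so one step of the
    method acts as a real affine function of [A], [M = alpha I + beta A], where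
    [alpha + i beta sqrt nu = f(i x)] with [x = tau sqrt nu].  By the matrix
    determinant lemma [f(z) = det(I - z(G - e w^T)) / det(I - z G)], and
    multiplying by the conjugate gives [|f(i x)| = psi].  Since
    [det(I + t B) = 1 + t tr B + O(t^2)] and the CFL condition gives
    [t = tau^2 nu <= c sigma C pi tau], the sign of the difference of the traces
    decides the first part; for the second part
    [tau <= C2 sqrt h] is exactly what keeps [x] inside [[-C1, C1]]. *)

(** * Determinants of perturbations of the identity *)

Lemma horner_char_poly_det (F : comNzRingType) (n : nat) (A : 'M[F]_n) (x : F) :
  (char_poly A).[x] = \det (x%:M - A).
Proof.
rewrite -horner_evalE -det_map_mx; congr (\det _).
by apply/matrixP=> i j; rewrite !mxE /= /horner_eval !hornerE hornerMn hornerX.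
Qed.

(** For nonzero [t] the determinant is [t ^+ n.+1] times the characteristic polynomial of [- B] at
    [t^-1]. Its two leading coefficients are [1] and [\tr B]; the others come with powers of [t] of
    exponent at least 2, and [K] is the sum of their absolute values. *)
Lemma det_1addZ (R : realFieldType) (n : nat) (B : 'M[R]_n.+1) :
  exists2 K : R, 0 <= K & forall t, 0 <= t <= 1 ->
    `|\det (1%:M + t *: B) - (1 + t * \tr B)| <= K * t ^+ 2.
Proof.
exists (\sum_(i < n) `|(char_poly (- B))`_i|); first exact: sumr_ge0.
move=> t /andP[t0 t1].
have [->|tn0] := eqVneq t 0.
  by rewrite scale0r addr0 det1 mul0r addr0 subrr normr0 mulr_ge0 ?sumr_ge0.
have -> : 1%:M + t *: B = t *: (t^-1%:M - - B).
  by rewrite opprK scalerDr scale_scalar_mx divff.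
rewrite detZ -horner_char_poly_det horner_coef size_char_poly.
have lead1 : (char_poly (- B))`_n.+1 = 1.
  by have /monicP := char_poly_monic (- B); rewrite lead_coefE size_char_poly.
have subtr : (char_poly (- B))`_n = \tr B.
  by rewrite (@char_poly_trace _ n.+1) // raddfN opprK.
rewrite !big_ord_recr /= lead1 subtr !mulrDr mul1r -exprMn divff // expr1n.
have -> : t ^+ n.+1 * (\tr B * t^-1 ^+ n) = t * \tr B.
  by rewrite exprS mulrACA [_ * _ ^+ n]mulrC -exprMn mulVf ?expr1n ?mulr1.
set S := _ * \sum_(i < n) _; have -> : S + t * \tr B + 1 - (1 + t * \tr B) = S by ring.
rewrite /S mulr_sumr mulr_suml; apply: le_trans (ler_norm_sum _ _ _) _.
apply: ler_sum => i _; rewrite mulrCA normrM ler_wpM2l //.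
have lt_in := ltn_ord i; rewrite exprVn -expfB ?ltnS ?(ltnW lt_in) //.
rewrite ger0_norm ?exprn_ge0 //; apply: ler_wiXn2l => //.
by rewrite subSn ?(ltnW lt_in) // ltnS subn_gt0.
Qed.

(** One block matrix is factored in two ways into block triangular ones. For [n = 1] this reduces a
    rank-one update to a scalar. *)
Lemma det_1addM (F : comNzRingType) (m n : nat) (U : 'M[F]_(m, n)) (V : 'M[F]_(n, m)) :
  \det (1%:M + U *m V) = \det (1%:M + V *m U).
Proof.
have e1 : block_mx 1%:M (- U) V 1%:M =
    block_mx 1%:M 0 V 1%:M *m block_mx 1%:M (- U) 0 (1%:M + V *m U).
  rewrite mulmx_block !mul1mx !mul0mx !mulmx1 ?mulmx0 !addr0 mulmxN.
  by rewrite addrA addrAC addNr add0r.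
have e2 : block_mx 1%:M (- U) V 1%:M =
    block_mx (1%:M + U *m V) (- U) 0 1%:M *m block_mx 1%:M 0 V 1%:M.
  rewrite mulmx_block !mul1mx !mul0mx !mulmx1 ?mulmx0 !add0r mulNmx.
  by rewrite addrK.
have := congr1 determinant e2; rewrite e1 !det_mulmx !det_lblock !det_ublock !det1.
by rewrite !mul1r !mulr1.
Qed.

(** * The stability function on the imaginary axis *)

Lemma toC_1addZ (R : realType) (n : nat) (B : 'M[R]_n) (t : R) :
  toC (1%:M + t *: B) = 1%:M + t%:C *: toC B.
Proof. by apply/matrixP=> i j; rewrite !mxE rmorphD /= rmorphM rmorph_nat. Qed.

Lemma cmod_sqr (R : realType) (z : R[i]) : (cmod z ^+ 2)%:C = z * z^*.
Proof. by rewrite -sqr_normc normc_def rmorphXn /=; case: z. Qed.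

Lemma mul_imaginary_conj (R : realType) (n : nat) (B : 'M[R]_n.+1) (x : R) :
  (1%:M - (0 +i* x) *: toC B) *m (1%:M + (0 +i* x) *: toC B) =
  toC (1%:M + x ^+ 2 *: B ^+ 2).
Proof.
rewrite mulmxDr !mulmxDl !mulNmx !mulmx1 !mul1mx -scalemxAl -scalemxAr scalerA.
have -> : (0 +i* x) * (0 +i* x) = - (x ^+ 2)%:C by simpc; rewrite expr2.
by rewrite scaleNr opprK addrA addrNK [B ^+ 2]expr2 -mulmxE -map_mxM -toC_1addZ.
Qed.

(** As [B] is real, conjugation only flips the sign of the imaginary term, so [z * z^*] is the
    determinant of the product in [mul_imaginary_conj]. *)
Lemma cmod_det (R : realType) (n : nat) (B : 'M[R]_n.+1) (x : R) :
  cmod (\det (1%:M - (0 +i* x) *: toC B)) ^+ 2 = \det (1%:M + x ^+ 2 *: B ^+ 2).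
Proof.
apply: (@complexI R); rewrite cmod_sqr -!det_map_mx -det_mulmx; congr (\det _).
have -> : map_mx conjc (1%:M - (0 +i* x) *: toC B) = 1%:M + (0 +i* x) *: toC B.
  by apply/matrixP=> i j; rewrite !mxE rmorphB rmorphM rmorphMn rmorph1 /= oppr0; simpc.
exact: mul_imaginary_conj.
Qed.

(** Matrix determinant lemma: replacing [G] by [GmewT G w] adds the rank-one term [z e w^T] to [A];
    once [A] is factored out, [det_1addM] leaves a 1 x 1 determinant, which is [f(z)]. *)
Lemma stability_function_det (R : realType) (s : nat) (G : 'M[R]_s.+1)
    (w : 'cV[R]_s.+1) (z : R[i]) :
  (1%:M - z *: toC G) \in unitmx ->
  stability_function G w z * \det (1%:M - z *: toC G) =
  \det (1%:M - z *: toC (GmewT G w)).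
Proof.
move=> uA; set A := 1%:M - z *: toC G in uA *.
have -> : 1%:M - z *: toC (GmewT G w) =
    A *m (1%:M + (invmx A *m (z *: (const_mx 1 : 'cV_s.+1))) *m (toC w)^T).
  rewrite mulmxDr mulmx1 -mulmxA mulKVmx // -scalemxAl.
  rewrite /toC map_mxB map_mxM map_const_mx rmorph1 map_trmx scalerBr opprB.
  by rewrite /A -addrA [- _ + _]addrC.
rewrite det_mulmx det_1addM det_mx11 mulrC; congr (_ * _).
by rewrite -!scalemxAr mulmxA [RHS]mxE; congr (_ + _); rewrite [RHS]mxE.
Qed.

(* [stability_function (0 +i* x) = stab_re (x ^+ 2) +i* (x * stab_im (x ^+ 2))]:
   clearing the complex inverse leaves real functions of [t = x ^+ 2]. *)
Definition stab_re {R : realType} {s : nat} (G : 'M[R]_s.+1) (w : 'cV[R]_s.+1)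
    (t : R) : R :=
  1 - t * (w^T *m invmx (1%:M + t *: G ^+ 2) *m G *m (const_mx 1 : 'cV_s.+1)) 0 0.

Definition stab_im {R : realType} {s : nat} (G : 'M[R]_s.+1) (w : 'cV[R]_s.+1)
    (t : R) : R :=
  (w^T *m invmx (1%:M + t *: G ^+ 2) *m (const_mx 1 : 'cV_s.+1)) 0 0.

Lemma unit_imaginary (R : realType) (n : nat) (B : 'M[R]_n.+1) (x : R) :
  (1%:M - (0 +i* x) *: toC B \in unitmx) = (1%:M + x ^+ 2 *: B ^+ 2 \in unitmx).
Proof.
rewrite !unitmxE !unitfE -cmod_det expf_eq0 /=; congr (~~ _).
by apply/eqP/eqP => [->|/ComplexField.Normc.eq0_normc //]; rewrite ComplexField.Normc.normc0.
Qed.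

Lemma stability_functionE (R : realType) (s : nat) (G : 'M[R]_s.+1)
    (w : 'cV[R]_s.+1) (x : R) :
  1%:M + x ^+ 2 *: G ^+ 2 \in unitmx ->
  stability_function G w (0 +i* x) =
  stab_re G w (x ^+ 2) +i* (x * stab_im G w (x ^+ 2)).
Proof.
move=> uQ; have uA := uQ; rewrite -unit_imaginary in uA.
set z := 0 +i* x in uA *; set Q := 1%:M + _ in uQ.
have AE : (1%:M - z *: toC G) *m (1%:M + z *: toC G) = toC Q.
  exact: mul_imaginary_conj.
(* [G] commutes with [Q], hence with its inverse, so the complex inverse is that of a real matrix
   times the conjugate factor. *)
have invE : invmx (1%:M - z *: toC G) = toC (invmx Q) *m (1%:M + z *: toC G).
  have QG : Q *m G = G *m Q.
    by rewrite /Q mulmxDl mulmxDr mul1mx mulmx1 -scalemxAl -scalemxAr !mulmxE -exprSr -exprS.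
  have PG : G *m invmx Q = invmx Q *m G.
    by rewrite -[G in LHS](mulKmx uQ) QG -!mulmxA mulmxV // mulmx1.
  rewrite -[LHS]mulmx1 -[RHS](mulKmx uA); congr (_ *m _).
  have -> : toC (invmx Q) *m (1%:M + z *: toC G) = (1%:M + z *: toC G) *m toC (invmx Q).
    by rewrite mulmxDr mulmxDl mulmx1 mul1mx -scalemxAr -scalemxAl -!map_mxM PG.
  by rewrite mulmxA AE -map_mxM mulmxV // map_mx1.
have eC : (const_mx 1 : 'cV[R[i]]_s.+1) = toC (const_mx 1).
  by rewrite /toC map_const_mx.
rewrite /stability_function invE eC mulmxDr mulmx1 -scalemxAr mulmxDr mulmxDl.
rewrite -scalemxAr -scalemxAl /toC !matrix.map_trmx -!map_mxM !mulmxA.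
rewrite /stab_re /stab_im -/Q; set U := w^T *m _ *m const_mx 1; set V := _ *m G *m _.
move: U V => U V.
have -> : (map_mx (real_complex R) U + z *: map_mx (real_complex R) V) 0 0 =
    (U 0 0)%:C + z * (V 0 0)%:C by rewrite !mxE.
apply/eqP; rewrite eq_complex /z /=; apply/andP; split; apply/eqP; ring.
Qed.

Lemma det_GmewT (R : realType) (s : nat) (G : 'M[R]_s.+1) (w : 'cV[R]_s.+1) (x : R) :
  1%:M + x ^+ 2 *: G ^+ 2 \in unitmx ->
  \det (1%:M + x ^+ 2 *: GmewT G w ^+ 2) =
  cmod (stability_function G w (0 +i* x)) ^+ 2 * \det (1%:M + x ^+ 2 *: G ^+ 2).
Proof.
move=> uQ; rewrite -!cmod_det -stability_function_det ?unit_imaginary //.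
by rewrite ComplexField.Normc.normcM exprMn.
Qed.

(** Links the real determinants in [psi] to the modulus of [f]; invertibility makes the denominator
    nonzero, so that it cancels. *)
Lemma psi_stability_function (R : realType) (s : nat) (G : 'M[R]_s.+1)
    (w : 'cV[R]_s.+1) (tau nu x : R) :
  x ^+ 2 = tau ^+ 2 * nu -> 1%:M + x ^+ 2 *: G ^+ 2 \in unitmx ->
  psi G w tau nu = cmod (stability_function G w (0 +i* x)).
Proof.
move=> xE uQ; rewrite /psi -xE det_GmewT // -normf_div mulfK; last first.
  by move: uQ; rewrite unitmxE unitfE.
rewrite ger0_norm ?sqr_ge0 // sqrtr_sqr ger0_norm //.
by rewrite /cmod; case: stability_function => a b; exact: sqrtr_ge0.
Qed.

Lemma psi_stab (R : realType) (s : nat) (G : 'M[R]_s.+1)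
    (w : 'cV[R]_s.+1) (tau nu : R) (t := tau ^+ 2 * nu) :
  0 <= nu -> 1%:M + t *: G ^+ 2 \in unitmx ->
  psi G w tau nu = Num.sqrt (stab_re G w t ^+ 2 + t * stab_im G w t ^+ 2).
Proof.
move=> nu0 uQ; have tE : (tau * Num.sqrt nu) ^+ 2 = t by rewrite exprMn sqr_sqrtr.
rewrite (psi_stability_function _ _ _ _ _ _ _ tE) ?tE // stability_functionE ?tE //=.
by rewrite [(_ * stab_im _ _ _) ^+ 2]exprMn tE.
Qed.

(** * One Runge-Kutta step as a matrix *)

(** Only the square of [A] matters: eliminating the stages gives [f(tau A)], which [A *m A = - nu]
    reduces to degree one in [A]. The three symbols are thus treated at once. *)
Lemma growth_matrix_stab (R : realType) (s : nat) (G : 'M[R]_s.+1)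
    (w : 'cV[R]_s.+1) (tau nu : R) (A : 'M[R[i]]_2) (t := tau ^+ 2 * nu) :
  A *m A = (- nu%:C)%:M -> 1%:M + t *: G ^+ 2 \in unitmx ->
  growth_matrix G w tau A
    ((stab_re G w t)%:C%:M + (tau * stab_im G w t)%:C *: A).
Proof.
move=> A2 uQ y y1; set Q := 1%:M + _ in uQ; set e : 'cV[R[i]]_s.+1 := const_mx 1.
(* With the stages as the rows of [K], the stage equations read [K = E + L K],
   and [1 - L^2] is left multiplication by [Q]. *)
pose L (K : 'M[R[i]]_(s.+1, 2)) := tau%:C *: (toC G *m K *m A^T).
have AT2 : A^T *m A^T = (- nu%:C)%:M by rewrite -trmx_mul A2 tr_scalar_mx.
have L2 K : L (L K) = - t%:C *: (toC (G ^+ 2) *m K).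
  rewrite /L -scalemxAr -scalemxAl scalerA -!mulmxA AT2 !mulmxA mul_mx_scalar scalerA.
  rewrite expr2 /toC map_mxM; congr (_ *: _).
  by rewrite -rmorphM /t mulrN -rmorphM expr2.
have LD K K' : L (K + K') = L K + L K' by rewrite /L mulmxDr mulmxDl scalerDr.
have LN K : L (- K) = - L K by rewrite /L mulmxN mulNmx scalerN.
have L2Q K : K - L (L K) = toC Q *m K.
  by rewrite L2 scaleNr opprK scalemxAl -[X in X + _]mul1mx -mulmxDl -toC_1addZ.
have uQC : toC Q \in unitmx by rewrite map_unitmx.
(* [K0] is the solution predicted by [(1 - L)^-1 = (1 - L^2)^-1 (1 + L)]. *)
pose E := e *m y^T *m A^T; pose K0 := toC (invmx Q) *m (E + L E).
have stageP K : K = E + L K <-> K = K0.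
  split=> [eqK | ->].
    have -> : K0 = invmx (toC Q) *m (E + L E) by rewrite /K0 /toC map_invmx.
    rewrite -[LHS](mulKmx uQC) -L2Q; congr (_ *m _).
    have LK : L K = L E + L (L K) by rewrite {1}eqK LD.
    by rewrite {1}eqK {1}LK addrA addrK.
  have QK0 : toC Q *m K0 = E + L E by rewrite mulmxA -map_mxM mulmxV // map_mx1 mul1mx.
  (* The residual [D = (1 - L) K0 - E] satisfies [(1 + L) D = (1 - L^2) K0 - (1 + L) E = 0]. Hence
     [(1 - L^2) D = 0], and [Q] being invertible forces [D = 0]. *)
  pose D := K0 - (E + L K0).
  have LD0 : L D = - D.
    have := L2Q K0; rewrite QK0 => /(canRL (subrK _)) K0E.
    apply/eqP; rewrite -addr_eq0 /D LD LN LD; move: K0E.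
    move: (K0) (L K0) (L (L K0)) (L E) => d a c b ->.
    rewrite -[E + b + c]addrA [E + (b + c)]addrC [- (E + a)]opprD [b + c + E + _]addrA addrK.
    by rewrite addrA subrK subrr.
  have : toC Q *m D = 0 by rewrite -L2Q LD0 LN LD0 opprK subrr.
  move/(congr1 (mulmx (invmx (toC Q)))); rewrite mulKmx // mulmx0.
  by move/eqP; rewrite subr_eq0 => /eqP.
pose mxK (K : 'I_s.+1 -> 'cV[R[i]]_2) := \matrix_i (K i)^T.
have sum_mx (u : 'rV[R]_s.+1) K : (\sum_j (u 0 j)%:C *: K j)^T = toC u *m mxK K.
  rewrite mulmx_sum_row raddf_sum; apply: eq_bigr => j _.
  by rewrite rowK mxE; apply/matrixP=> a b; rewrite !mxE.
have trmxDZ (a : R[i]) (u v : 'cV[R[i]]_2) : (u + a *: v)^T = u^T + a *: v^T.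
  by apply/matrixP=> p q; rewrite !mxE.
have stage_mx K : (forall i, K i = A *m (y + tau%:C *: \sum_j (G i j)%:C *: K j)) <->
    mxK K = E + L (mxK K).
  have stageE i : row i (E + L (mxK K)) =
      (A *m (y + tau%:C *: \sum_j (G i j)%:C *: K j))^T.
    have -> : \sum_j (G i j)%:C *: K j = \sum_j (row i G 0 j)%:C *: K j.
      by apply: eq_bigr => j _; rewrite mxE.
    rewrite trmx_mul trmxDZ sum_mx raddfD /= /E /L !row_mul row_const mulmxDl.
    have -> : const_mx 1 = 1%:M :> 'rV[R[i]]_1 by apply/rowP=> j; rewrite !mxE ord1.
    rewrite mul1mx; congr (_ + _).
    by rewrite linearZ /= !row_mul -scalemxAl /toC map_row.
  split=> [eqK|/row_matrixP eqK i].
    by apply/row_matrixP => i; rewrite stageE -eqK rowK.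
  by apply: trmx_inj; rewrite -stageE -eqK rowK.
have step_mx K : (y + tau%:C *: \sum_i (w i 0)%:C *: K i)^T =
    y^T + tau%:C *: (toC w^T *m mxK K).
  rewrite trmxDZ -sum_mx; congr (_ + _ *: _^T).
  by apply: eq_bigr => i _; rewrite mxE.
have eC : toC (const_mx 1) = const_mx 1 :> 'cV[R[i]]_s.+1.
  by rewrite /toC map_const_mx.
(* In the update, the [E] part of [K0] yields the [stab_im] term; in the [L E] part [A] occurs
   twice, giving the factor [- nu] and hence [stab_re - 1]. *)
have final : y^T + tau%:C *: (toC w^T *m K0) =
    (((stab_re G w t)%:C%:M + (tau * stab_im G w t)%:C *: A) *m y)^T.
  have imE : toC w^T *m toC (invmx Q) *m e = (stab_im G w t)%:C%:M.
    rewrite /e -eC -!map_mxM [LHS]mx11_scalar /stab_im -/Q; congr (_%:M).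
    by rewrite mxE.
  set V := (w^T *m invmx Q *m G *m (const_mx 1 : 'cV_s.+1)) 0 0.
  have VE : toC w^T *m toC (invmx Q) *m toC G *m e = V%:C%:M.
    by rewrite /e -eC -!map_mxM [LHS]mx11_scalar mxE.
  have -> : toC w^T *m K0 =
      (stab_im G w t)%:C *: (y^T *m A^T) + (tau%:C * V%:C * - nu%:C) *: y^T.
    rewrite /K0 /E /L !mulmxDr -!scalemxAr !mulmxA imE VE !mul_scalar_mx -scalemxAl.
    rewrite -[_ *m A^T *m A^T]mulmxA AT2 mul_mx_scalar !scalerA.
    by congr (_ + _ *: _); ring.
  rewrite mulmxDl mul_scalar_mx -scalemxAl trmxDZ trmx_mul.
  have -> : ((stab_re G w t)%:C *: y)^T = (stab_re G w t)%:C *: y^T.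
    by apply/matrixP=> p q; rewrite !mxE.
  rewrite scalerDr !scalerA addrCA addrC -[X in X + _ + _]scale1r -scalerDl rmorphM.
  congr (_ *: _ + _).
  by rewrite /stab_re -/Q -/V /t !rmorphB /= !rmorphM; ring.
split=> [[K /stage_mx/stageP eqK ->]|->].
  by apply: trmx_inj; rewrite step_mx eqK.
pose K i := (row i K0)^T.
have KE : mxK K = K0 by apply/row_matrixP => i; rewrite rowK trmxK.
exists K; first by apply/stage_mx/stageP.
by apply: trmx_inj; rewrite step_mx KE.
Qed.

(** * Eigenvalues and norms of the growth matrices *)

Lemma mx22_sqr (R : realType) (a b d g : R[i]) (l : R[i]) :
  a * a + b * d = l -> d * b + g * g = l -> a * b + b * g = 0 -> d * a + g * d = 0 ->
  mx22 a b d g *m mx22 a b d g = l%:M.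
Proof.
move=> aa gg ab dg.
rewrite [RHS](@scalar_mx_block _ 1 1).
apply: (etrans (@mulmx_block _ 1 1 1 1 1 1 _ _ _ _ _ _ _ _)).
by rewrite -!scalar_mxM -!raddfD aa gg ab dg /= !raddf0.
Qed.

Lemma sum_ord2 (V : nmodType) (F : 'I_2 -> V) : \sum_i F i = F 0 + F 1.
Proof.
by rewrite !big_ord_recl big_ord0 addr0; congr (F _ + F _); apply: val_inj.
Qed.

(** A product of equations instead of a conjunction, so that [rewrite] can use both as a
    multirule. *)
Lemma mulmx22_col (R : realType) (a b d g : R[i]) (x : 'cV[R[i]]_2) :
  ((mx22 a b d g *m x) 0 0 = a * x 0 0 + b * x 1 0) *
  ((mx22 a b d g *m x) 1 0 = d * x 0 0 + g * x 1 0).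
Proof.
have i0 : (0 : 'I_2) = @lshift 1 1 0 by apply: val_inj.
have i1 : (1 : 'I_2) = @rshift 1 1 0 by apply: val_inj.
have E00 : mx22 a b d g 0 0 = a by rewrite i0 (@block_mxEul _ 1 1 1 1) mxE.
have E01 : mx22 a b d g 0 1 = b by rewrite i0 i1 (@block_mxEur _ 1 1 1 1) mxE.
have E10 : mx22 a b d g 1 0 = d by rewrite i0 i1 (@block_mxEdl _ 1 1 1 1) mxE.
have E11 : mx22 a b d g 1 1 = g by rewrite i1 (@block_mxEdr _ 1 1 1 1) mxE.
by split; rewrite mxE sum_ord2 ?E00 ?E01 ?E10 ?E11.
Qed.

(** On an eigenvector [(l - a)^2 = - b^2 nu], so [l = a + i b sqrt nu] or its conjugate. No
    diagonalization is involved, so [nu = 0] is covered. *)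
Lemma common_modulus_stab (R : realType) (nu a b : R) (A : 'M[R[i]]_2) :
  0 <= nu -> A *m A = (- nu%:C)%:M ->
  common_modulus (a%:C%:M + b%:C *: A) (Num.sqrt (a ^+ 2 + b ^+ 2 * nu)).
Proof.
move=> nu0 A2 l /eigenvalueP[v].
rewrite mulmxDr mul_mx_scalar -scalemxAr => /(canRL (addKr _)).
rewrite addrC -scalerBl => vA v0.
have : (l - a%:C) ^+ 2 *: v = (0 +i* (b * Num.sqrt nu)) ^+ 2 *: v.
  rewrite expr2 -scalerA -vA !scalerA mulrC -scalerA scalemxAl -vA.
  rewrite -scalemxAl -mulmxA A2 mul_mx_scalar !scalerA; congr (_ *: _).
  have -> : (0 +i* (b * Num.sqrt nu)) ^+ 2 = - ((b * Num.sqrt nu) ^+ 2)%:C.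
    by rewrite expr2 (expr2 (b * _)); simpc.
  by rewrite exprMn sqr_sqrtr // rmorphM expr2 rmorphM /=; ring.
move/eqP; rewrite -subr_eq0 -scalerBl scaler_eq0 (negPf v0) orbF subr_eq0 eqf_sqr.
rewrite -{3}(sqr_sqrtr nu0) -exprMn.
by move=> /orP[] /eqP/(canRL (subrK _)) -> /=; rewrite ?oppr0 !add0r addr0 ?sqrrN.
Qed.

(** The matrix is a rotation times a scalar: it stretches every vector by the same factor, and the
    supremum is over a singleton. *)
Lemma spectral_norm_rot (R : realType) (a b : R) :
  spectral_norm (mx22 a%:C b%:C (- b)%:C a%:C) = Num.sqrt (a ^+ 2 + b ^+ 2).
Proof.
have norm2 (x : 'cV[R[i]]_2) :
    l2norm x = Num.sqrt (cmod (x 0 0) ^+ 2 + cmod (x 1 0) ^+ 2).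
  by rewrite /l2norm sum_ord2.
rewrite /spectral_norm -[RHS]sup1; congr (sup _).
have normM x : l2norm (mx22 a%:C b%:C (- b)%:C a%:C *m x) =
    Num.sqrt (a ^+ 2 + b ^+ 2) * l2norm x.
  rewrite !norm2 !mulmx22_col -sqrtrM ?addr_ge0 ?sqr_ge0 //; congr Num.sqrt.
  case: (x 0 0) (x 1 0) => [p q] [p' q'] /=.
  by rewrite !sqr_sqrtr ?addr_ge0 ?sqr_ge0 //; ring.
apply/seteqP; split=> [_ [x /= x1 <-]|_ ->] /=; first by rewrite normM x1 mulr1.
have e1 : l2norm (delta_mx 0 0 : 'cV[R[i]]_2) = 1.
  rewrite norm2 !mxE /=.
  by rewrite !expr0n !expr1n /= !addr0 sqrtr1 sqrtr0 expr1n expr0n /= addr0 sqrtr1.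
by exists (delta_mx 0 0) => //; rewrite normM e1 mulr1.
Qed.

Lemma psi_is_growth_unit (R : realType) (s : nat) (G : 'M[R]_s.+1) (w : 'cV[R]_s.+1)
    (c sigma tau : R) (k : int) (t := tau ^+ 2 * nu c sigma k) :
  0 < c -> 0 < sigma -> 1%:M + t *: G ^+ 2 \in unitmx ->
  psi_is_growth G w c sigma tau k.
Proof.
move=> c0 s0 uQ; have nu0 : 0 <= nu c sigma k.
  by apply: mulr_ge0; [rewrite mulr_ge0 ?ltW | exact: normr_ge0].
have common A : A *m A = (- (nu c sigma k)%:C)%:M ->
    common_modulus ((stab_re G w t)%:C%:M + (tau * stab_im G w t)%:C *: A)
      (psi G w tau (nu c sigma k)).
  move=> A2; rewrite psi_stab // -/t.
  have -> : t * stab_im G w t ^+ 2 = (tau * stab_im G w t) ^+ 2 * nu c sigma k.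
    by rewrite exprMn /t mulrAC.
  exact: common_modulus_stab.
have S1sq : S1 c sigma k *m S1 c sigma k = (- (nu c sigma k)%:C)%:M.
  by apply: mx22_sqr; rewrite ?(mulr0, mul0r, addr0, add0r) // /nu -rmorphN -rmorphM;
    congr _%:C; ring.
have S2sq : S2 c sigma k *m S2 c sigma k = (- (nu c sigma k)%:C)%:M.
  by apply: mx22_sqr; rewrite ?(mulr0, mul0r, addr0, add0r) // -rmorphN -rmorphM;
    congr _%:C; rewrite -{3}(sqr_sqrtr nu0); ring.
have S3sq : S3 c sigma k *m S3 c sigma k = (- (nu c sigma k)%:C)%:M.
  by apply: mx22_sqr; rewrite ?(mulr0, mul0r, addr0, add0r) // -{3}(sqr_sqrtr nu0);
    simpc; rewrite expr2.
split.
- by eexists; [exact: growth_matrix_stab S1sq uQ | exact: common].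
- eexists; first exact: growth_matrix_stab S2sq uQ.
  split; first exact: common.
  (* The skew form of [S2] makes its growth matrix a scaled rotation, for which norm and eigenvalue
     modulus agree. *)
  have -> : (stab_re G w t)%:C%:M + (tau * stab_im G w t)%:C *: S2 c sigma k =
      mx22 (stab_re G w t)%:C (tau * stab_im G w t * Num.sqrt (nu c sigma k))%:C
        (- (tau * stab_im G w t * Num.sqrt (nu c sigma k)))%:C (stab_re G w t)%:C.
    rewrite /S2 /mx22 [X in X + _](@scalar_mx_block _ 1 1).
    rewrite (@scale_block_mx _ 1 1 1 1) (@add_block_mx _ 1 1 1 1).
    have sc0 : 0%:M = 0 :> 'M[R[i]]_1 by exact: raddf0.
    by rewrite sc0 scaler0 !addr0 !add0r !scale_scalar_mx -!rmorphM mulrN.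
  rewrite spectral_norm_rot psi_stab // -/t; congr (Num.sqrt (_ + _)).
  by rewrite !exprMn sqr_sqrtr // mulrAC.
- by eexists; [exact: growth_matrix_stab S3sq uQ | exact: common].
Qed.

(** * Mesh bounds and first-order comparison of ratios *)

Lemma det_1addZ_sqr_ge0 (R : realType) (n : nat) (B : 'M[R]_n.+1) (t : R) :
  0 <= t -> 0 <= \det (1%:M + t *: B ^+ 2).
Proof. by move=> t0; rewrite -[t](sqr_sqrtr t0) -cmod_det sqr_ge0. Qed.

Lemma abs_mode_le (R : realType) (N : nat) (k : int) :
  ~~ odd N -> k \in modes N -> abs_mode k <= N%:R / 2 :> R.
Proof.
move=> oN; rewrite inE => /andP[k1 k2].
have -> : N%:R / 2 = (N./2)%:~R :> R.
  by rewrite -[N in LHS]even_halfK // -muln2 natrM mulfK.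
rewrite /abs_mode ler_norml -intrN !ler_int k2 andbT.
by apply: le_trans k1; rewrite lerDl.
Qed.

Lemma abs_mode_mesh (R : realType) (N : nat) (k : int) :
  (0 < N)%N -> ~~ odd N -> k \in modes N -> abs_mode k * mesh N <= pi :> R.
Proof.
move=> N0 oN kN; have Npos : 0 < N%:R :> R by rewrite ltr0n.
have pi0 : 0 < pi :> R := pi_gt0 R.
have -> : pi = N%:R / 2 * mesh N :> R by rewrite /mesh; field; rewrite lt0r_neq0.
by rewrite ler_wpM2r ?abs_mode_le // /mesh divr_ge0 ?mulr_ge0 // ltW.
Qed.

Lemma psi_sqrt (R : realType) (s : nat) (G : 'M[R]_s.+1) (w : 'cV[R]_s.+1)
    (tau nu : R) (t := tau ^+ 2 * nu) : 0 <= t ->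
  psi G w tau nu =
  Num.sqrt (\det (1%:M + t *: GmewT G w ^+ 2) / \det (1%:M + t *: G ^+ 2)).
Proof. by move=> t0; rewrite /psi -/t !ger0_norm // det_1addZ_sqr_ge0. Qed.

(** Linearizes the square root in [psi]; this is the source of the factor 1/2 in [L]. *)
Lemma sqrtr_le_mean1 (R : rcfType) (r : R) : 0 <= r -> Num.sqrt r <= (1 + r) / 2.
Proof.
move=> r0; have := sqr_ge0 (Num.sqrt r - 1).
by rewrite sqrrB sqr_sqrtr // mulr1 expr1n; lra.
Qed.

Lemma first_order_ratio_lt (R : realFieldType) (b b' K : R) : 0 <= K -> b' < b ->
  exists2 e : R, 0 < e & forall t D N : R, 0 <= t <= e ->
    `|D - (1 + t * b)| <= K * t ^+ 2 -> `|N - (1 + t * b')| <= K * t ^+ 2 ->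
    [/\ 0 < D, N <= D & 0 < t -> N < D].
Proof.
move=> K0 bb; have b0 : 0 <= `|b| by [].
have K1 : 0 < 2 * K + 1 by lra.
have M1 : 0 < 2 * (`|b| + K + 1) by lra.
(* The second bound keeps [D] at least 1/2; the third gives [2 K t < b - b'] for [t > 0], strictly
   because of the added 1. *)
exists (Num.min 1 (Num.min (1 / (2 * (`|b| + K + 1))) ((b - b') / (2 * K + 1)))).
  by rewrite !lt_min ltr01 !divr_gt0 // subr_gt0.
move=> t D N; rewrite !le_min !ler_pdivlMr // => /and4P[t0 t1 tM tK].
rewrite !ler_norml => /andP[D1 _] /andP[_ N2].
have tt : t ^+ 2 <= t by rewrite expr2 ler_piMr.
have Ktt : K * t ^+ 2 <= K * t by rewrite ler_wpM2l.
have tb : t * - `|b| <= t * b by rewrite ler_wpM2l // lerNnormlW.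
have step : N - D <= t * (b' - b + 2 * K * t) by lra.
have neg : t != 0 -> b' - b + 2 * K * t < 0.
  move=> tn0; have tp : 0 < t by rewrite lt0r tn0.
  lra.
have D0 : 0 < D by lra.
have ND : 0 < t -> N < D.
  move=> tp; rewrite -subr_lt0; apply: le_lt_trans step _.
  by rewrite pmulr_rlt0 // neg // lt0r_neq0.
split=> //; have [t00|tn0] := eqVneq t 0; last by rewrite ltW // ND // lt0r tn0.
by rewrite -subr_le0 (le_trans step) // t00 mul0r.
Qed.

(** With [N <= D + p] and [1 / D <= 1 + M t], the ratio is at most [1 + p (1 + M t)]. *)
Lemma first_order_ratio_le (R : realFieldType) (b b' K : R) : 0 <= K -> b <= b' ->
  exists2 e : R, 0 < e & exists2 B : R, 0 <= B & forall t D N : R, 0 <= t <= e ->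
    `|D - (1 + t * b)| <= K * t ^+ 2 -> `|N - (1 + t * b')| <= K * t ^+ 2 ->
    0 < D /\ N / D <= 1 + t * (b' - b) + B * t ^+ 2.
Proof.
move=> K0 bb; have b0 : 0 <= `|b| by [].
pose M := 2 * (`|b| + K); have M0 : 0 <= M by rewrite /M; lra.
have M1 : 0 < M + 1 by lra.
have d0 : 0 <= b' - b by rewrite subr_ge0.
exists (Num.min 1 (1 / (M + 1))); first by rewrite lt_min ltr01 divr_gt0.
(* The quadratic and cubic coefficients of [p (1 + M t)]; the cubic one is absorbed since
   [t <= 1]. *)
exists (2 * K + M * (b' - b) + 2 * K * M).
  by have := mulr_ge0 K0 M0; have := mulr_ge0 M0 d0; lra.
move=> t D N; rewrite !le_min !ler_pdivlMr // => /and3P[t0 t1 tM].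
rewrite !ler_norml => /andP[D1 _] /andP[_ N2].
have tt : t ^+ 2 <= t by rewrite expr2 ler_piMr.
have Ktt : K * t ^+ 2 <= K * t by rewrite ler_wpM2l.
have tb : t * - `|b| <= t * b by rewrite ler_wpM2l // lerNnormlW.
pose p := t * (b' - b) + 2 * K * t ^+ 2.
have p0 : 0 <= p by rewrite addr_ge0 ?mulr_ge0 ?sqr_ge0.
have NDp : N <= D + p by rewrite /p; lra.
have Mt : M * t <= 1 by lra.
have Mt0 : 0 <= M * t by rewrite mulr_ge0.
have Dlow : 1 - M * t / 2 <= D by rewrite /M; lra.
have D0 : 0 < D by lra.
split=> //; rewrite ler_pdivrMr //.
(* [(1 + M t) (1 - M t / 2) = 1 + M t (1 - M t) / 2], and [M t <= 1]. *)
have MD : 1 <= (1 + M * t) * D.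
  apply: le_trans (_ : (1 + M * t) * (1 - M * t / 2) <= _); last first.
    by rewrite ler_wpM2l // addr_ge0.
  nra.
have pMD : p <= p * ((1 + M * t) * D) by rewrite ler_peMr.
apply: le_trans NDp (le_trans (_ : _ <= (1 + p * (1 + M * t)) * D) _).
  by rewrite mulrDl mul1r -mulrA lerD2l.
rewrite ler_pM2r // -!addrA lerD2l.
have MKt : K * M * t ^+ 3 <= K * M * t ^+ 2.
  rewrite [t ^+ 3]exprS; apply: ler_wpM2l; first exact: mulr_ge0.
  by apply: ler_piMl; first exact: sqr_ge0.
rewrite /p; lra.
Qed.

Lemma det_1addZ_pair (R : realFieldType) (n : nat) (A B : 'M[R]_n.+1) :
  exists2 K : R, 0 <= K & forall t, 0 <= t <= 1 ->
    `|\det (1%:M + t *: A) - (1 + t * \tr A)| <= K * t ^+ 2 /\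
    `|\det (1%:M + t *: B) - (1 + t * \tr B)| <= K * t ^+ 2.
Proof.
have [K K0 KA] := det_1addZ R n A; have [L L0 LB] := det_1addZ R n B.
exists (K + L) => [|t t01]; first exact: addr_ge0.
split; [apply: le_trans (KA t t01) _ | apply: le_trans (LB t t01) _];
  by rewrite ler_wpM2r ?sqr_ge0 // ?lerDl ?lerDr.
Qed.

(** The CFL condition trades one factor [tau] against [|k|]: [tau |k| <= C h |k| <= C pi]. So
    [tau^2 nu] is [O(tau)] uniformly in [N] and [k]. *)
Lemma cfl_bound (R : realType) (c sigma C tau : R) (N : nat) (k : int) :
  0 < c -> 0 < sigma -> 0 < C -> 0 < tau ->
  (0 < N)%N -> ~~ odd N -> k \in modes N -> tau <= C * mesh N ->
  [/\ 0 <= tau ^+ 2 * nu c sigma k, k != 0 -> 0 < tau ^+ 2 * nu c sigma k &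
    tau ^+ 2 * nu c sigma k <= c * sigma * C * pi * tau].
Proof.
move=> c0 s0 C0 tau0 N0 oN kN tauC.
have cs0 : 0 < c * sigma by rewrite mulr_gt0.
have k0 : 0 <= abs_mode k :> R by exact: normr_ge0.
split.
- by rewrite !mulr_ge0 ?sqr_ge0 // ltW.
- by move=> kn0; rewrite !mulr_gt0 ?exprn_gt0 // normr_gt0 intr_eq0.
have -> : tau ^+ 2 * nu c sigma k = c * sigma * (tau * abs_mode k) * tau.
  by rewrite /nu; ring.
rewrite ler_wpM2r ?(ltW tau0) // -[c * sigma * C * pi]mulrA ler_wpM2l ?(ltW cs0) //.
apply: le_trans (ler_wpM2r k0 tauC) _.
by rewrite -mulrA [mesh N * _]mulrC ler_wpM2l ?(ltW C0) // abs_mode_mesh.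
Qed.

Lemma det_gt0_unitmx (R : realFieldType) (n : nat) (B : 'M[R]_n) :
  0 < \det B -> B \in unitmx.
Proof. by move=> B0; rewrite unitmxE unitfE lt0r_neq0. Qed.

(** * Stability under the step-size conditions *)

(** The strict bound excludes [k = 0], where [nu = 0] and [psi = 1]. *)
Lemma cfl_strong (R : realType) (c sigma : R) (s : nat) (G : 'M[R]_s.+1)
    (w : 'cV[R]_s.+1) (C : R) :
  0 < c -> 0 < sigma -> 0 < C -> \tr ((GmewT G w) ^+ 2) < \tr (G ^+ 2) ->
  \forall tau \near (0 : R)^'+, forall (N : nat) (k : int),
    (0 < N)%N -> ~~ odd N -> k \in modes N -> tau <= C * mesh N ->
    [/\ psi_is_growth G w c sigma tau k,
        psi G w tau (nu c sigma k) <= 1 &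
        k != 0 -> psi G w tau (nu c sigma k) < 1].
Proof.
move=> c0 s0 C0 trlt.
have [K K0 detK] := det_1addZ_pair R s (G ^+ 2) (GmewT G w ^+ 2).
have [e e0 ratio] := first_order_ratio_lt R _ _ K K0 trlt.
pose E := c * sigma * C * pi.
have E0 : 0 < E by rewrite !mulr_gt0 ?pi_gt0.
(* [tau] is fixed before [N] and [k]: its thresholds depend only on [E] and [e]. *)
near=> tau => N k N0 oN kN tauC.
have tau0 : 0 < tau by near: tau; exact: nbhs_right_gt.
have [t0 tgt0 tle] := cfl_bound R c sigma C tau N k c0 s0 C0 tau0 N0 oN kN tauC.
have te : tau ^+ 2 * nu c sigma k <= e.
  apply: le_trans tle _; rewrite -/E mulrC -ler_pdivlMr //.
  by near: tau; apply: nbhs_right_le; rewrite divr_gt0.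
have t1 : tau ^+ 2 * nu c sigma k <= 1.
  apply: le_trans tle _; rewrite -/E mulrC -ler_pdivlMr //.
  by near: tau; apply: nbhs_right_le; rewrite divr_gt0.
have t01 : 0 <= tau ^+ 2 * nu c sigma k <= 1 by rewrite t0.
have t0e : 0 <= tau ^+ 2 * nu c sigma k <= e by rewrite t0.
have [Dk Nk] := detK _ t01; have [D0 ND NltD] := ratio _ _ _ t0e Dk Nk.
split; first by apply: psi_is_growth_unit => //; exact: det_gt0_unitmx.
  by rewrite psi_sqrt // -[leRHS]sqrtr1 ler_wsqrtr // ler_pdivrMr // mul1r.
move=> kn0; rewrite psi_sqrt // -[ltRHS]sqrtr1 ltr_sqrt // ltr_pdivrMr // mul1r.
exact: NltD (tgt0 kn0).
Unshelve. all: by end_near. Qed.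

Lemma cfl_weak (R : realType) (c sigma : R) (s : nat) (G : 'M[R]_s.+1)
    (w : 'cV[R]_s.+1) (C : R) :
  0 < c -> 0 < sigma -> 0 < C -> \tr (G ^+ 2) <= \tr ((GmewT G w) ^+ 2) ->
  exists L : R,
    0 <= L <= \tr ((GmewT G w) ^+ 2 - G ^+ 2) * c * sigma * C * pi / 2 /\
    exists B : R,
      \forall tau \near (0 : R)^'+, forall (N : nat) (k : int),
        (0 < N)%N -> ~~ odd N -> k \in modes N -> tau <= C * mesh N ->
        psi_is_growth G w c sigma tau k /\
        psi G w tau (nu c sigma k) <= 1 + L * tau + B * tau ^+ 2.
Proof.
move=> c0 s0 C0 trle.
have [K K0 detK] := det_1addZ_pair R s (G ^+ 2) (GmewT G w ^+ 2).
have [e e0 [B B0 ratio]] := first_order_ratio_le R _ _ K K0 trle.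
pose E := c * sigma * C * pi.
have E0 : 0 < E by rewrite !mulr_gt0 ?pi_gt0.
pose d := \tr ((GmewT G w) ^+ 2) - \tr (G ^+ 2).
have d0 : 0 <= d by rewrite subr_ge0.
have LE : \tr ((GmewT G w) ^+ 2 - G ^+ 2) * c * sigma * C * pi / 2 = d * E / 2.
  by rewrite raddfB -/d /E !mulrA.
(* [L] is taken at the upper end of its allowed range. *)
exists (d * E / 2); rewrite LE lexx andbT; split.
  by apply: divr_ge0 => //; apply: mulr_ge0 => //; exact: ltW.
(* The quadratic remainder [B t^2], with [t <= E tau], halved by the square root bound. *)
exists (B * E ^+ 2 / 2).
near=> tau => N k N0 oN kN tauC.
have tau0 : 0 < tau by near: tau; exact: nbhs_right_gt.
have [t0 _ tle] := cfl_bound R c sigma C tau N k c0 s0 C0 tau0 N0 oN kN tauC.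
have te : tau ^+ 2 * nu c sigma k <= e.
  apply: le_trans tle _; rewrite -/E mulrC -ler_pdivlMr //.
  by near: tau; apply: nbhs_right_le; rewrite divr_gt0.
have t1 : tau ^+ 2 * nu c sigma k <= 1.
  apply: le_trans tle _; rewrite -/E mulrC -ler_pdivlMr //.
  by near: tau; apply: nbhs_right_le; rewrite divr_gt0.
have t01 : 0 <= tau ^+ 2 * nu c sigma k <= 1 by rewrite t0.
have t0e : 0 <= tau ^+ 2 * nu c sigma k <= e by rewrite t0.
have [Dk Nk] := detK _ t01; have [D0 NDle] := ratio _ _ _ t0e Dk Nk.
split; first by apply: psi_is_growth_unit => //; exact: det_gt0_unitmx.
rewrite psi_sqrt //; apply: le_trans (sqrtr_le_mean1 _ _ _) _.
  by rewrite divr_ge0 ?det_1addZ_sqr_ge0.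
move: (_ / _) NDle => r; rewrite -/d; move: (tau ^+ 2 * _) t0 tle => t t0 tle rle.
have td : t * d <= E * tau * d by rewrite ler_wpM2r.
have tB : B * t ^+ 2 <= B * (E * tau) ^+ 2.
  by rewrite ler_wpM2l // lerXn2r ?nnegrE // mulr_ge0 // ltW.
rewrite exprMn in tB; lra.
Unshelve. all: by end_near. Qed.

Lemma sqrt_mesh_strong (R : realType) (c sigma : R) (s : nat) (G : 'M[R]_s.+1)
    (w : 'cV[R]_s.+1) (C1 : R) :
  0 < c -> 0 < sigma -> 0 < C1 ->
  (forall y : R, - C1 <= y <= C1 -> stability_region G w (0 +i* y)) ->
  exists2 C2 : R, 0 < C2 &
    forall (N : nat) (k : int) (tau : R),
      (0 < N)%N -> ~~ odd N -> k \in modes N ->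
      0 < tau -> tau <= C2 * Num.sqrt (mesh N) ->
      psi_is_growth G w c sigma tau k /\
      psi G w tau (nu c sigma k) <= 1.
Proof.
move=> c0 s0 C10 stab.
have cs0 : 0 < c * sigma by rewrite mulr_gt0.
have csp0 : 0 < c * sigma * pi by rewrite mulr_gt0 ?pi_gt0.
(* Chosen so that [C2^2 c sigma pi = C1^2]; then [x^2 = tau^2 nu <= C2^2 c sigma |k| h <= C1^2]. *)
exists (C1 / Num.sqrt (c * sigma * pi)); first by rewrite divr_gt0 ?sqrtr_gt0.
move=> N k tau N0 oN kN tau0 tauC.
have h0 : 0 <= mesh N :> R by rewrite /mesh divr_ge0 ?mulr_ge0 // ?pi_ge0.
have k0 : 0 <= abs_mode k :> R by exact: normr_ge0.
have nu0 : 0 <= nu c sigma k by rewrite /nu mulr_ge0 // ltW.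
pose x := tau * Num.sqrt (nu c sigma k).
have xE : x ^+ 2 = tau ^+ 2 * nu c sigma k by rewrite exprMn sqr_sqrtr.
have x0 : 0 <= x by rewrite mulr_ge0 ?sqrtr_ge0 // ltW.
have tau2 : tau ^+ 2 <= C1 ^+ 2 / (c * sigma * pi) * mesh N.
  have := lerXn2r 2 (ltW tau0 : tau \is Num.nneg) (le_trans (ltW tau0) tauC) tauC.
  by rewrite !exprMn exprVn !sqr_sqrtr // ltW.
have xC : x <= C1.
  rewrite -(ler_pXn2r (ltn0Sn 1)) ?nnegrE ?(ltW C10) // xE.
  apply: le_trans (ler_wpM2r nu0 tau2) _.
  have -> : C1 ^+ 2 / (c * sigma * pi) * mesh N * nu c sigma k =
      C1 ^+ 2 / pi * (abs_mode k * mesh N).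
    have pi0 : 0 < pi :> R := pi_gt0 R.
    rewrite /nu; move: (pi) pi0 => p p0; field.
    by rewrite !lt0r_neq0.
  by rewrite mulrAC ler_pdivrMr ?pi_gt0 // ler_pM2l ?exprn_gt0 // abs_mode_mesh.
(* Membership in the region gives both the solvability of the stages and the bound on [f]. *)
have [|uA fle] := stab x; first by rewrite xC andbT (le_trans _ x0) // oppr_le0 ltW.
rewrite unit_imaginary in uA.
split; first by apply: psi_is_growth_unit; rewrite -?xE.
by rewrite (psi_stability_function _ _ _ _ _ _ _ xE).
Qed.

Theorem theorem1 (R : realType) (c sigma : R) (hc : 0 < c) (hsigma : 0 < sigma)
    (s : nat) (G : 'M[R]_s.+1) (w : 'cV[R]_s.+1) :
  (forall C : R, 0 < C ->
    (\tr ((GmewT G w) ^+ 2) < \tr (G ^+ 2) ->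
      \forall tau \near (0 : R)^'+, forall (N : nat) (k : int),
        (0 < N)%N -> ~~ odd N -> k \in modes N -> tau <= C * mesh N ->
        [/\ psi_is_growth G w c sigma tau k,
            psi G w tau (nu c sigma k) <= 1 &
            k != 0 -> psi G w tau (nu c sigma k) < 1])
    /\
    (\tr (G ^+ 2) <= \tr ((GmewT G w) ^+ 2) ->
      exists L : R,
        0 <= L <= \tr ((GmewT G w) ^+ 2 - G ^+ 2) * c * sigma * C * pi / 2 /\
        exists B : R,
          \forall tau \near (0 : R)^'+, forall (N : nat) (k : int),
            (0 < N)%N -> ~~ odd N -> k \in modes N -> tau <= C * mesh N ->
            psi_is_growth G w c sigma tau k /\
            psi G w tau (nu c sigma k) <= 1 + L * tau + B * tau ^+ 2))
  /\
  (forall C1 : R, 0 < C1 ->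
    (forall y : R, - C1 <= y <= C1 -> stability_region G w (0 +i* y)) ->
    exists2 C2 : R, 0 < C2 &
      forall (N : nat) (k : int) (tau : R),
        (0 < N)%N -> ~~ odd N -> k \in modes N ->
        0 < tau -> tau <= C2 * Num.sqrt (mesh N) ->
        psi_is_growth G w c sigma tau k /\
        psi G w tau (nu c sigma k) <= 1).
Proof.
split=> [C C0|C1 C10 stab]; last exact: sqrt_mesh_strong stab.
by split=> tr; [exact: cfl_strong | exact: cfl_weak].
Qed.
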